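(* Let $P\in\mathcal{P}$ be a path and let $d_P:\Lambda\to\Lambda$ be the associated path operator. Then $d_P$ is the operator of multiplication by $d_P(1)$, i.e. $d_P(F)=d_P(1)\cdot F$ for all $F\in\Lambda$.
   Context: $\Lambda$ is the algebra of symmetric functions in $x_1,x_2,\dots$ over $\mathbb{Q}(q,t)$, $e_r$ the elementary symmetric functions (with $e_0=1$), $p_r$ the power sums. For $k\ge 0$ let $V_k=\Lambda[y_1,\dots,y_k]$, so $V_0=\Lambda$. For $F=F[X]\in V_k$ and a variable $y$, the plethystic substitution $F[X\pm(q-1)y]$ is obtained by replacing each $p_r$ by $p_r\pm(q^r-1)y^r$, leaving the $y_i$'s in $F$ unchanged. For $k\ge2$ and $1\le i\le k-1$, define $T_i:V_k\to V_k$ by $$T_iF=\frac{(q-1)\,y_i\,F+(y_{i+1}-q\,y_i)\,s_iF}{y_{i+1}-y_i},$$ where $s_i$ exchanges $y_i$ and $y_{i+1}$. Define $d_+:V_k\to V_{k+1}$ for $k\ge0$ by $$d_+F=T_1T_2\cdots T_k\big(F[X+(q-1)y_{k+1}]\big),$$ $d_-:V_k\to V_{k-1}$ for $k\ge1$ by $$d_-F=-F[X-(q-1)y_k]\sum_{i\ge0}(-1/y_k)^ie_i[X]\Big|_{y_k^{-1}},$$ where $|_{y_k^{-1}}$ denotes taking the coefficient of $y_k^{-1}$, and $\varphi:V_k\to V_k$ for $k\ge1$ by $$\varphi=\frac1{q-1}(d_-d_+-d_+d_-).$$ $\mathcal{P}$ is the set of lattice paths from $(0,0)$ to $(n,n)$,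 for some $n\in\mathbb{N}$, made of north steps $(0,1)$, east steps $(1,0)$ and diagonal steps $(1,1)$, staying weakly above the line $y=x$ and having no diagonal step along the line $y=x$. A path is encoded by the word in $\{-,0,+\}$ obtained by reading its steps from $(0,0)$ to $(n,n)$ and writing $-$ for a north step, $0$ for a diagonal step, $+$ for an east step. The path operator $d_P:V_0\to V_0$ is obtained from this word by replacing each $-$ by $d_-$, each $0$ by $\varphi$, each $+$ by $d_+$, and composing these operators in the written order (the rightmost letter acts first). For example, the word $(-,-,0,0,+,0,+)$ gives $d_P=d_-d_-\varphi\varphi d_+\varphi d_+$. *)

(* Defs.v *)
From HB Require Import structures.
From mathcomp Require Import all_boot all_order all_algebra all_fingroup.
From mathcomp Require Import mpoly.
From mathcomp Require boolp.
From Stdlib Require Import ClassicalEpsilon.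

Set Implicit Arguments.
Unset Strict Implicit.
Unset Printing Implicit Defensive.

Import GRing.Theory.
Local Open Scope ring_scope.

(* A symmetric function in x_1, x_2, ... is given by its restrictions f_n to the variables
   x_1, ..., x_n: symmetric polynomials of bounded degree such that setting
   x_{n+1} = 0 in f_{n+1} gives f_n. *)

Section SymFun.
Variable R : fieldType.

(* [muni] expands a polynomial in powers of its last variable, so its constant
   coefficient is the specialization of that variable to 0. *)
Definition last0 n (f : {mpoly R[n.+1]}) : {mpoly R[n]} := (muni f)`_0.

Definition is_symfun (f : forall n, {mpoly R[n]}) : Prop :=
  [/\ forall n, f n \is symmetric,
      forall n, last0 (f n.+1) = f n
    & exists d, forall n, (msize (f n) <= d)%N].

Record symfun := SymFun {
  restr :> forall n, {mpoly R[n]};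
  symfunP : is_symfun restr }.

Lemma symfun_eq (f g : symfun) : (forall n, f n = g n) -> f = g.
Proof.
case: f g => [f fP] [g gP] /= fg.
have e : f = g by apply: boolp.functional_extensionality_dep.
by case: _ / e gP => gP; rewrite (boolp.Prop_irrelevance fP gP).
Qed.

HB.instance Definition _ := boolp.gen_eqMixin symfun.
HB.instance Definition _ := boolp.gen_choiceMixin symfun.

Lemma last0D n (f g : {mpoly R[n.+1]}) : last0 (f + g) = last0 f + last0 g.
Proof. by rewrite /last0 muniD coefD. Qed.

Lemma last0M n (f g : {mpoly R[n.+1]}) : last0 (f * g) = last0 f * last0 g.
Proof. by rewrite /last0 muniM coef0M. Qed.

Lemma last0C n c : last0 (c%:MP : {mpoly R[n.+1]}) = c%:MP.
Proof. by rewrite /last0 muniC coefC. Qed.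

Lemma is_symfunC c : is_symfun (fun n => c%:MP).
Proof.
split=> [n|n|]; last by exists 1%N => n; rewrite msizeC; case: (c != 0).
  by rewrite -[c%:MP]alg_mpolyC rpredZ ?rpred1.
exact: last0C.
Qed.

Lemma is_symfunD (f g : symfun) : is_symfun (fun n => f n + g n).
Proof.
case: f g => [f [f1 f2 [d fd]]] [g [g1 g2 [e ge]]] /=.
split=> [n|n|]; first by rewrite rpredD ?f1 ?g1.
  by rewrite last0D f2 g2.
exists (maxn d e) => n; apply: leq_trans (msizeD_le _ _) _.
by rewrite geq_max !leq_max fd ge orbT.
Qed.

Lemma is_symfunM (f g : symfun) : is_symfun (fun n => f n * g n).
Proof.
case: f g => [f [f1 f2 [d fd]]] [g [g1 g2 [e ge]]] /=.
split=> [n|n|]; first by rewrite rpredM ?f1 ?g1.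
  by rewrite last0M f2 g2.
exists (d + e).+1 => n; apply: leq_trans (msizeM_le _ _) _.
by rewrite ltnS leq_add.
Qed.

Definition symfunC c := SymFun (is_symfunC c).
Definition symfun_add f g := SymFun (is_symfunD f g).
Definition symfun_mul f g := SymFun (is_symfunM f g).
Definition symfun_scale c f := symfun_mul (symfunC c) f.

Fact symfun_addA : associative symfun_add.
Proof. by move=> f g h; apply: symfun_eq => n /=; rewrite addrA. Qed.
Fact symfun_addC : commutative symfun_add.
Proof. by move=> f g; apply: symfun_eq => n /=; rewrite addrC. Qed.
Fact symfun_add0 : left_id (symfunC 0) symfun_add.
Proof. by move=> f; apply: symfun_eq => n /=; rewrite mpolyC0 add0r. Qed.
Fact symfun_addN :
  left_inverse (symfunC 0) (symfun_scale (-1)) symfun_add.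
Proof.
move=> f; apply: symfun_eq => n /=.
by rewrite mpolyCN mpolyC1 mulN1r addNr mpolyC0.
Qed.

HB.instance Definition _ := GRing.isZmodule.Build symfun
  symfun_addA symfun_addC symfun_add0 symfun_addN.

Fact symfun_mulA : associative symfun_mul.
Proof. by move=> f g h; apply: symfun_eq => n /=; rewrite mulrA. Qed.
Fact symfun_mulC : commutative symfun_mul.
Proof. by move=> f g; apply: symfun_eq => n /=; rewrite mulrC. Qed.
Fact symfun_mul1 : left_id (symfunC 1) symfun_mul.
Proof. by move=> f; apply: symfun_eq => n /=; rewrite mpolyC1 mul1r. Qed.
Fact symfun_mulDl : left_distributive symfun_mul symfun_add.
Proof. by move=> f g h; apply: symfun_eq => n /=; rewrite mulrDl. Qed.
Fact symfun_neq0 : symfunC 1 != 0.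
Proof.
apply/eqP=> /(congr1 (fun f : symfun => f 0)) /= /eqP.
by rewrite mpolyC0 mpolyC1 oner_eq0.
Qed.

HB.instance Definition _ := GRing.Zmodule_isComNzRing.Build symfun
  symfun_mulA symfun_mulC symfun_mul1 symfun_mulDl symfun_neq0.

Fact symfun_scaleA a b f :
  symfun_scale a (symfun_scale b f) = symfun_scale (a * b) f.
Proof. by apply: symfun_eq => n /=; rewrite mulrA mpolyCM. Qed.
Fact symfun_scale1 : left_id 1 symfun_scale.
Proof. exact: symfun_mul1. Qed.
Fact symfun_scaleDr : right_distributive symfun_scale +%R.
Proof. by move=> a f g; apply: symfun_eq => n /=; rewrite mulrDr. Qed.
Fact symfun_scaleDl f : {morph symfun_scale^~ f : a b / a + b}.
Proof. by move=> a b; apply: symfun_eq => n /=; rewrite mpolyCD mulrDl. Qed.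

HB.instance Definition _ := GRing.Zmodule_isLmodule.Build R symfun
  symfun_scaleA symfun_scale1 symfun_scaleDr symfun_scaleDl.

Fact symfun_scaleAl a (f g : symfun) : a *: (f * g) = a *: f * g.
Proof. exact: symfun_mulA. Qed.

HB.instance Definition _ :=
  GRing.Lmodule_isLalgebra.Build R symfun symfun_scaleAl.
HB.instance Definition _ := GRing.Lalgebra_isComAlgebra.Build R symfun.


Lemma last0X n (m : 'X_{1..n.+1}) :
  last0 ('X_[m] : {mpoly R[n.+1]}) =
    'X_[[multinom m (widen_ord (leqnSn n) i) | i < n]] *+ (m ord_max == 0%N).
Proof.
rewrite /last0 muniE msuppX big_seq1 mcoeffX eqxx scale1r coefZ coefXn.
by rewrite mulr_natr eq_sym.
Qed.

Lemma last0_mwiden n (p : {mpoly R[n]}) : last0 (mwiden p) = p.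
Proof.
elim/mpolyind: p => [|c m p _ _ IHp]; first by rewrite mwiden0 -mpolyC0 last0C.
rewrite mwidenD mwidenZ mwidenX last0D IHp; congr (_ + _).
rewrite -mul_mpolyC last0M last0C last0X mnmwiden_ordmax mulr1n mul_mpolyC.
by congr (_ *: 'X_[_]); apply/mnmP=> i; rewrite mnmE mnmwiden_widen.
Qed.

Lemma last0_max n : last0 ('X_ord_max : {mpoly R[n.+1]}) = 0.
Proof. by rewrite last0X mnm1E eqxx. Qed.

Lemma is_symfun_elem r : is_symfun (fun n => mesym n R r).
Proof.
split=> [n|n|]; first exact: mesym_sym.
  case: r => [|r]; first by rewrite !mesym0E -mpolyC1 last0C.
  by rewrite mesymSS last0D last0M !last0_mwiden last0_max mulr0 addr0.
exists r.+1 => n; apply/bigmax_leqP_seq => m m_in _.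
by rewrite ltnS (dhomog_mf (dhomog_mesym n R r) m_in).
Qed.

Lemma is_symfun_psum r : is_symfun (fun n => \sum_(i < n) 'X_i ^+ r.+1).
Proof.
split=> [n|n|].
- apply/issymP=> s; rewrite raddf_sum [RHS](reindex_inj (@perm_inj _ s)) /=.
  apply: eq_bigr => i _.
  by rewrite (rmorphXn (msym s)) /= /msym mmapX mmap1U.
- rewrite big_ord_recr /= last0D exprS last0M last0_max mul0r addr0.
  rewrite -[RHS]last0_mwiden (raddf_sum (@mwiden n R)); congr (last0 _).
  apply: eq_bigr => i _ /=.
  by rewrite (rmorphXn (@mwiden n R)) /= mwidenX mnmwiden1.
- exists r.+2 => n; apply: leq_trans (msize_sum _ _ _) _.
  by apply/bigmax_leqP=> i _; rewrite mpolyXn msizeX mdegMn mdeg1 mul1n.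
Qed.

(* [elem r] is e_r, with e_0 = 1; [psum r] is p_{r+1}. *)
Definition elem r : symfun := SymFun (is_symfun_elem r).
Definition psum r : symfun := SymFun (is_symfun_psum r).

End SymFun.

(* Q(q,t) *)
Notation Qqt := {fraction {mpoly rat[2]}}.

Definition q : Qqt := tofrac 'X_0.
Definition t : Qqt := tofrac 'X_1.

Notation Lambda := (symfun Qqt).

(* V_k = Lambda[y_1, ..., y_k]; the variable y_i is 'X_(i-1), and the last
   variable y_k of V_k is 'X_ord_max. *)
Notation V k := {mpoly Lambda[k]}.

Definition cst k (c : Qqt) : V k := (c%:A : Lambda)%:MP.

(* The morphism of Q(q,t)-algebras Lambda -> V_k sending p_r to a r, for all
   r >= 1; it exists and is unique because the power sums freely generate
   Lambda. *)
Definition subst_psum_spec k (a : nat -> V k) (h : {rmorphism Lambda -> V k}) :=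
  (forall c : Qqt, h c%:A = cst k c) /\ (forall r, h (psum _ r) = a r.+1).

Definition subst_psum k (a : nat -> V k) : {rmorphism Lambda -> V k} :=
  epsilon (inhabits (@mpolyC k Lambda : {rmorphism Lambda -> V k}))
          (subst_psum_spec a).

(* [pleth e y F] is F[X + e (q-1) y], for e = 1 or e = -1: only the
   coefficients of F in Lambda are affected. *)
Definition pleth k (e : Qqt) (y : V k) (F : V k) : V k :=
  mmap (subst_psum (fun r =>
          (psum _ r.-1)%:MP + cst k (e * (q ^+ r - 1)) * y ^+ r))
       (fun i => 'X_i) F.

(* T_{i+1} : V_{k+1} -> V_{k+1} for 0 <= i < k. *)
Section T.
Variables (k : nat) (i : 'I_k).
Let i0 : 'I_k.+1 := widen_ord (leqnSn k) i.
Let i1 : 'I_k.+1 := lift ord0 i.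

(* The quotient is exact, and unique because y_{i+2} - y_{i+1} is not a zero
   divisor. *)
Definition T (F : V k.+1) : V k.+1 :=
  epsilon (inhabits 0) (fun G : V k.+1 =>
    ('X_i1 - 'X_i0) * G =
    cst k.+1 (q - 1) * 'X_i0 * F
      + ('X_i1 - cst k.+1 q * 'X_i0) * msym (tperm i0 i1) F).
End T.

Definition dplus k (F : V k) : V k.+1 :=
  foldr (fun (i : 'I_k) (G : V k.+1) => T i G)
        (pleth 1 'X_ord_max (mwiden F)) (enum 'I_k).

(* If F[X - (q-1) y_{k+1}] = \sum_j g_j y_{k+1}^j with g_j in V_k, then the
   coefficient of y_{k+1}^{-1} in its product with
   \sum_i (-1/y_{k+1})^i e_i is \sum_j g_j (-1)^{j+1} e_{j+1}. *)
Definition dminus k (F : V k.+1) : V k :=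
  let G := muni (pleth (-1) 'X_ord_max F) in
  - \sum_(j < size G) G`_j * ((-1) ^+ j.+1 * (elem _ j.+1)%:MP).

Definition phi k (F : V k.+1) : V k.+1 :=
  cst k.+1 (q - 1)^-1 * (dminus (dplus F) - dplus (dminus F)).

Inductive step := North | Diag | East.

Definition move (a : nat * nat) (s : step) : nat * nat :=
  match s with
  | North => (a.1, a.2.+1)
  | Diag => (a.1.+1, a.2.+1)
  | East => (a.1.+1, a.2)
  end.

Definition endpoint (w : seq step) : nat * nat := foldl move (0, 0)%N w.

Definition is_path (w : seq step) : Prop :=
  [/\ exists n, endpoint w = (n, n),
      forall w1 w2, w = w1 ++ w2 -> ((endpoint w1).1 <= (endpoint w1).2)%N
    & forall w1 w2, w = w1 ++ Diag :: w2 -> (endpoint w1).1 <> (endpoint w1).2].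

Record lattice_path := LatticePath { word :> seq step; pathP : is_path word }.

(* The letters -, 0, + act on V_k by d_-, phi, d_+. Since d_- and phi are not
   defined on V_0, they are given the value 0 there; this case does not occur
   in the operator of a path. *)
Definition shift (s : step) (k : nat) : nat :=
  match s with North => k.-1 | Diag => k | East => k.+1 end.

Definition letter_op (s : step) (k : nat) : V k -> V (shift s k) :=
  match s return V k -> V (shift s k) with
  | North => match k return V k -> V k.-1 with
             | 0 => fun _ => 0
             | k'.+1 => @dminus k'
             end
  | Diag => match k return V k -> V k with
            | 0 => fun _ => 0
            | k'.+1 => @phi k'
            end
  | East => @dplus k
  end.

Definition level (w : seq step) : nat := foldr shift 0%N w.

Fixpoint word_op (w : seq step) (F : V 0) : V (level w) :=
  match w return V (level w) with
  | [::] => F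
  | s :: w' => letter_op s (word_op w' F)
  end.

Lemma level_path (P : lattice_path) : level P = 0%N.
Proof.
case: P => w [[n wn] above offdiag] /=.
suff lev w1 w2 : w = w1 ++ w2 ->
    (level w2 + (endpoint w1).1 = (endpoint w1).2)%N.
  by have := lev [::] w erefl; rewrite addn0.
elim: w2 w1 => [|s w2 IH] w1 def_w.
  by rewrite -[w1]cats0 -def_w wn.
have := IH (rcons w1 s); rewrite cat_rcons => /(_ def_w).
have := above _ _ def_w; rewrite /endpoint foldl_rcons.
case: foldl => x y /=; case: s {def_w} => /= le_xy.
- case: (level w2) => [|l] /=; last by rewrite addSn => -[].
  by rewrite add0n => e; move: le_xy; rewrite e ltnn.
- by rewrite addnS => -[].
- by rewrite addSn addnS.
Qed.

(* V_0 is identified with Lambda: F is seen as a constant polynomial, and the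
   result is read off as a constant coefficient. *)
Definition path_op (P : lattice_path) (F : Lambda) : Lambda :=
  (eq_rect (level P) (fun k => V k) (word_op P F%:MP) 0%N (level_path P))@_0%MM.

(* Main.v *)
(* Let F in Lambda act on V_k as multiplication by
   F[X + (q-1)(y_1 + ... + y_k)]. The substitution in d_- removes y_k from this
   multiplier and the one in d_+ adds y_{k+1} to it; since the multiplier is
   symmetric in the y_i, the T_i are linear over it. Hence d_-, d_+ and phi all
   commute with the action, and on V_0 the action is multiplication by F.

   The plethystic substitutions are only characterized by their values on the
   power sums, so one needs that Lambda is freely generated by these. By the
   fundamental theorem it is freely generated by the e_r, and in characteristic
   0 Newton's identities express the e_r and the p_r in terms of each other. *)

From HB Require Import structures.
Require Import Defs.
From mathcomp Require Import all_boot all_order all_algebra all_fingroup.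
From mathcomp Require Import mpoly.
From Stdlib Require Import ClassicalEpsilon.

Set Implicit Arguments.
Unset Strict Implicit.
Unset Printing Implicit Defensive.

Import GRing.Theory.
Local Open Scope ring_scope.

(** * Evaluation of polynomials and ring morphisms *)

Lemma eq_mmap n (R S : nzRingType) (f1 f2 : R -> S) (h1 h2 : 'I_n -> S) :
  f1 =1 f2 -> h1 =1 h2 -> mmap f1 h1 =1 mmap f2 h2.
Proof.
by move=> ef eh p; apply: eq_bigr => m _; rewrite ef (mmap1_eq _ eh).
Qed.

Lemma rmorph_mmap n (R S S' : nzRingType) (g : {rmorphism S -> S'})
    (f : R -> S) (h : 'I_n -> S) p :
  g (mmap f h p) = mmap (g \o f) (g \o h) p.
Proof.
rewrite /mmap rmorph_sum; apply: eq_bigr => m _.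
rewrite rmorphM rmorph_prod; congr (_ * _).
by apply: eq_bigr => i _; rewrite rmorphXn.
Qed.

Lemma rmorph_signM (R S : nzRingType) (h : {rmorphism R -> S}) j x y :
  h ((-1) ^+ j * (x * y)) = (-1) ^+ j * (h x * h y).
Proof. by rewrite (rmorphM h _ (x * y)) (rmorphM h x) rmorph_sign. Qed.

(** * Newton's identities in finitely many variables *)

Section Newton.
Variables (R : comNzRingType) (n : nat).

Let esum_mem r (i : 'I_n) : {mpoly R[n]} :=
  \sum_(A : {set 'I_n} | (#|A| == r) && (i \in A)) \prod_(j in A) 'X_j.

(* Removing x_i from the monomials of e_{r+1} divisible by x_i leaves the
   monomials of e_r not divisible by x_i. *)
Let esum_memS r i : esum_mem r.+1 i = 'X_i * (mesym n R r - esum_mem r i).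
Proof.
rewrite /mesym (bigID (fun A : {set 'I_n} => i \in A)) /= addrC addrK mulr_sumr.
rewrite /esum_mem (reindex_onto (fun A => i |: A) (fun A => A :\ i)) /=; last first.
  by move=> A /andP[_ iA]; rewrite setD1K.
apply: eq_big => [A|A].
  rewrite setU11 andbT cardsU1.
  case: (boolP (i \in A)) => iA /=; last by rewrite setU1K // eqxx eqSS.
  rewrite andbF; apply/negbTE/nandP; right; apply: contraTneq iA => <-.
  by rewrite setD11.
rewrite setU11 => /andP[_ /eqP eA]; rewrite big_setU1 //=.
by rewrite -eA setD11.
Qed.

(** Unfolds the recurrence [esum_memS] down to [esum_mem 0 i], which vanishes because the empty set
    does not contain [i]. *)
Let esum_memE r i :
  esum_mem r.+1 i = \sum_(j < r.+1) (-1) ^+ j * (mesym n R (r - j) * 'X_i ^+ j.+1).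
Proof.
elim: r => [|r IH]; rewrite esum_memS.
  rewrite big_ord1 expr0 mul1r subnn expr1 mulrC; congr (_ * _).
  rewrite /esum_mem big_pred0 ?subr0 // => A.
  by rewrite cards_eq0; case: eqP => // ->; rewrite inE.
rewrite IH [RHS]big_ord_recl expr0 mul1r subn0 expr1 mulrBr [mesym _ _ _ * _]mulrC.
congr (_ + _).
rewrite mulr_sumr -sumrN; apply: eq_bigr => j _; rewrite lift0.
have -> : (-1) ^+ j.+1 = - (-1) ^+ j :> {mpoly R[n]} by rewrite exprS mulN1r.
rewrite subSS mulNr mulrCA [X in _ = - (_ * (_ * X))]exprS.
by rewrite [X in - (_ * X)]mulrCA.
Qed.

(** Summing [esum_mem r.+1 i] over [i] counts each monomial of e_{r+1} once for each variable in it,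
    that is r+1 times. *)
Lemma newton_mesym r :
  mesym n R r.+1 *+ r.+1 =
  \sum_(j < r.+1) (-1) ^+ j * (mesym n R (r - j) * \sum_(i < n) 'X_i ^+ j.+1).
Proof.
transitivity (\sum_i esum_mem r.+1 i).
  rewrite /esum_mem (exchange_big_dep (fun A : {set 'I_n} => #|A| == r.+1)) /=;
    last by move=> i A _ /andP[].
  rewrite -sumrMnl; apply: eq_bigr => A cA.
  by rewrite cA /= sumr_const (eqP cA).
under eq_bigr do rewrite esum_memE.
rewrite exchange_big; apply: eq_bigr => j _.
by rewrite -!mulr_sumr.
Qed.
End Newton.

(** * Symmetric functions as polynomials in the e_r *)

Section SymFunFree.
Variable R : fieldType.
Local Notation Sym := (symfun R).

(* The coercion [restr], restated so that it can carry a morphism structure. *)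
Definition restrict n (f : Sym) : {mpoly R[n]} := f n.

Lemma restrict_is_zmod_morphism n : zmod_morphism (@restrict n).
Proof.
by move=> f g; rewrite /restrict /= mpolyCN mpolyC1 mulN1r.
Qed.
HB.instance Definition _ n :=
  GRing.isZmodMorphism.Build Sym {mpoly R[n]} (@restrict n)
    (@restrict_is_zmod_morphism n).

Lemma restrict_is_monoid_morphism n : monoid_morphism (@restrict n).
Proof. by split. Qed.
HB.instance Definition _ n :=
  GRing.isMonoidMorphism.Build Sym {mpoly R[n]} (@restrict n)
    (@restrict_is_monoid_morphism n).

Lemma restrict_alg n c : restrict n c%:A = c%:MP.
Proof. by rewrite /restrict /= mulr1. Qed.

Lemma restrict_eq (f g : Sym) :
  (forall n, restrict n f = restrict n g) -> f = g.
Proof. exact: symfun_eq. Qed.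

Lemma newton_symfun r :
  elem R r.+1 *+ r.+1 =
  \sum_(j < r.+1) (-1) ^+ j * (elem R (r - j) * psum R j).
Proof.
apply: restrict_eq => n; rewrite rmorphMn rmorph_sum.
rewrite [LHS]newton_mesym; apply: eq_bigr => j _.
by rewrite rmorph_signM.
Qed.

Lemma mcoeff_last0 n (f : {mpoly R[n.+1]}) m :
  (last0 f)@_m = f@_(mnmwiden m).
Proof.
elim/mpolyind: f => [|c m' f _ _ IH]; first by rewrite /last0 muni0 coef0 !mcoeff0.
rewrite last0D !mcoeffD; apply: (congr2 +%R _ IH).
rewrite -mul_mpolyC last0M last0C last0X mul_mpolyC !mcoeffCM mcoeffZ.
rewrite mcoeffMn !mcoeffX; congr (_ * _).
case: (eqVneq (m' ord_max) 0%N) => [m'0|m'N]; rewrite ?mulr1n ?mulr0n.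
  congr (nat_of_bool _)%:R; apply/eqP/eqP => [<-|->].
    apply/mnmP=> i; case: (unliftP ord_max i) => [j ->|->]; last first.
      by rewrite mnmwiden_ordmax.
    have -> : lift ord_max j = widen_ord (leqnSn n) j.
      by apply: val_inj; rewrite /= /bump leqNgt ltn_ord.
    by rewrite mnmwiden_widen mnmE.
  by apply/mnmP=> i; rewrite mnmE mnmwiden_widen.
case: eqP => // e; case/eqP: m'N; by rewrite e mnmwiden_ordmax.
Qed.

(* If f_n = 0, every monomial of f_{n+1} contains x_{n+1}, hence by symmetry all
   variables, which is impossible in degree at most n. *)
Lemma symfun_eq0 N (f : Sym) :
  f N = 0 -> (forall n, msize (f n) <= N.+1)%N -> f = 0.
Proof.
case: f => f fP /= fN fd; have [fsym flast _] := fP.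
apply: symfun_eq => n /=; rewrite mpolyC0.
have down k j : f (j + k)%N = 0 -> f j = 0.
  elim: k => [|k IH]; rewrite ?addn0 // addnS => e; apply: IH.
  by rewrite -flast e -mpolyC0 last0C mpolyC0.
have up k : f (N + k)%N = 0.
  elim: k => [|k IH]; rewrite ?addn0 // addnS.
  apply/mpolyP => m; rewrite mcoeff0; apply/eqP.
  rewrite mcoeff_eq0; apply/negP => m_in.
  have mlt : (mdeg m < (N + k).+1)%N.
    by rewrite (leq_trans (msize_mdeg_lt m_in)) // (leq_trans (fd _)) // ltnS leq_addr.
  have /existsP [i /eqP mi0] : [exists i, m i == 0%N].
    apply: contraLR mlt; rewrite negb_exists -leqNgt mdegE => /forallP mpos.
    rewrite -[X in (X <= _)%N](card_ord) -sum1_card leq_sum // => i _.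
    by rewrite lt0n mpos.
  have := m_in; rewrite -(issym_msupp (tperm i ord_max) _ (fsym _)).
  set m' := (X in X \in _); rewrite mcoeff_msupp => /eqP; apply.
  have -> : m' = mnmwiden [multinom m' (widen_ord (leqnSn (N + k)) j) | j < N + k].
    apply/mnmP=> j; case: (unliftP ord_max j) => [j' ->|->].
      have -> : lift ord_max j' = widen_ord (leqnSn _) j'.
        by apply: val_inj; rewrite /= /bump leqNgt ltn_ord.
      by rewrite mnmwiden_widen mnmE.
    by rewrite mnmwiden_ordmax /m' mnmE tpermR.
  by rewrite -mcoeff_last0 flast IH mcoeff0.
have [le_nN|/ltnW le_Nn] := leqP n N.
  by apply: (down (N - n)%N); rewrite subnKC.
by rewrite -(subnKC le_Nn) up.
Qed.

Local Notation ev iota b := (mmap iota (fun i => b (nat_of_ord i))).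

Lemma restrict_ev_elem n N (p : {mpoly R[N]}) :
  restrict n (ev (in_alg Sym) (fun i => elem R i.+1) p) =
  ev (@mpolyC n R) (fun i => mesym n R i.+1) p.
Proof. by rewrite rmorph_mmap; apply: eq_mmap => // c; apply: restrict_alg. Qed.

Lemma comp_mesymE N (p : {mpoly R[N]}) :
  p \mPo [tuple mesym N R i.+1 | i < N] =
  ev (@mpolyC N R) (fun i => mesym N R i.+1) p.
Proof. by apply: eq_mmap => // i; rewrite tnth_mktuple. Qed.

(** Restriction to [N] variables suffices: e_1, ..., e_N are already algebraically independent
    there. *)
Lemma ev_elem_inj N :
  injective (ev (in_alg Sym) (fun i => elem R i.+1) : {mpoly R[N]} -> Sym).
Proof.
move=> p p' /(congr1 (restrict N)); rewrite !restrict_ev_elem -!comp_mesymE.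
exact: msym_fundamental_un.
Qed.

(** The variable ['X_i] has weight i+1, which is the degree of its image e_{i+1}, so the weight of
    [p] bounds the degree of its image. *)
Lemma msize_ev_mesym n N (p : {mpoly R[N]}) :
  (msize (ev (@mpolyC n R) (fun i => mesym n R i.+1) p) <= mweight p)%N.
Proof.
rewrite /mmap; apply: leq_trans (msize_sum _ _ _) _.
apply/bigmax_leqP_seq => m m_in _; rewrite mul_mpolyC.
apply: leq_trans (msizeZ_le _ _) _.
apply: leq_trans (mmeasure_mnm_lt _ m_in).
have hm : mmap1 (fun i : 'I_N => mesym n R i.+1) m \is (mnmwgt m).-homog.
  rewrite /mmap1 /mnmwgt; apply: (big_ind2 (fun (p : {mpoly R[n]}) d => p \is d.-homog)).
  - exact: dhomog1.
  - by move=> *; apply: dhomogM.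
  - by move=> i _; rewrite mulnC; apply/dhomogMn/dhomog_mesym.
by apply/bigmax_leqP_seq => m' m'_in _; rewrite ltnS (dhomog_mf hm m'_in).
Qed.

(** Let [d] bound the size of all restrictions. An expression of f through the e_r in [d] variables
    is then valid in any number of variables, by [symfun_eq0] applied to the difference. *)
Lemma ev_elem_surj (f : Sym) :
  exists N (p : {mpoly R[N]}), ev (in_alg Sym) (fun i => elem R i.+1) p = f.
Proof.
have [fsym flast [d fd]] := symfunP f.
have [p [pf pw]] := sym_fundamental (fsym d).
exists d, p; apply/eqP; rewrite -subr_eq0; apply/eqP/(@symfun_eq0 d).
  rewrite -[LHS]/(restrict d _) rmorphB /= restrict_ev_elem -comp_mesymE pf.
  by rewrite subrr.
move=> n; rewrite -[X in msize X]/(restrict n _) rmorphB /= restrict_ev_elem.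
apply: leq_trans (msizeD_le _ _) _; rewrite msizeN geq_max.
rewrite ?(leq_trans (fd n)) // andbT.
by rewrite (leq_trans (msize_ev_mesym n p)) // (leq_trans pw) // (leq_trans (fd d)).
Qed.

(** Brings polynomials in different numbers of variables into a common ring. *)
Definition wide N M (le_NM : (N <= M)%N) (p : {mpoly R[N]}) : {mpoly R[M]} :=
  mmap (@mpolyC M R) (fun i => 'X_(widen_ord le_NM i)) p.

Lemma ev_wide (S : comNzRingType) (iota : {rmorphism R -> S}) (b : nat -> S)
    N M (le_NM : (N <= M)%N) (p : {mpoly R[N]}) :
  ev iota b (wide le_NM p) = ev iota b p.
Proof.
rewrite rmorph_mmap; apply: eq_mmap => [c|i] /=; first by rewrite mmapC.
by rewrite mmapX mmap1U.
Qed.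

(** * Morphisms with prescribed values on the e_r *)

Section Universal.
Variables (S : comNzRingType) (iota : {rmorphism R -> S}) (b : nat -> S).

(** The graph of the morphism to be built: [ev_elem_surj] makes it total and [ev_elem_inj] makes it
    single-valued. *)
Let rel (f : Sym) (s : S) := exists N (p : {mpoly R[N]}),
  f = ev (in_alg Sym) (fun i => elem R i.+1) p /\ s = ev iota b p.

Let rel_total f : exists s, rel f s.
Proof.
by have [N [p pf]] := ev_elem_surj f; exists (ev iota b p), N, p.
Qed.

Let rel_common f f' s s' : rel f s -> rel f' s' ->
  exists N (p p' : {mpoly R[N]}),
  [/\ f = ev (in_alg Sym) (fun i => elem R i.+1) p, s = ev iota b p,
      f' = ev (in_alg Sym) (fun i => elem R i.+1) p' & s' = ev iota b p'].
Proof.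
move=> [N [p [-> ->]]] [N' [p' [-> ->]]].
exists (maxn N N'), (wide (leq_maxl N N') p), (wide (leq_maxr N N') p').
by rewrite !(ev_wide _ (fun i => elem R i.+1)) !ev_wide.
Qed.

Let rel_fun f s s' : rel f s -> rel f s' -> s = s'.
Proof.
move=> fs fs'; have [N [p [p' [-> -> e ->]]]] := rel_common fs fs'.
by rewrite (ev_elem_inj e).
Qed.

Lemma symfun_elem_morphism : exists h : {rmorphism Sym -> S},
  (forall c, h c%:A = iota c) /\ (forall r, h (elem R r.+1) = b r).
Proof.
pose h f := proj1_sig (constructive_indefinite_description _ (rel_total f)).
have hP f s : rel f s -> h f = s.
  by move=> fs; rewrite /h; case: constructive_indefinite_description => s' /=;
    move/rel_fun; apply.
have hR f : rel f (h f).
  by rewrite /h; case: constructive_indefinite_description.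
have hB : zmod_morphism h.
  move=> f f'; have [N [p [p' [ef es ef' es']]]] := rel_common (hR f) (hR f').
  by apply: hP; exists N, (p - p'); rewrite es es' ef ef' !rmorphB.
have hM : monoid_morphism h.
  split=> [|f f']; first by apply: hP; exists 0%N, 1; rewrite !rmorph1.
  have [N [p [p' [ef es ef' es']]]] := rel_common (hR f) (hR f').
  by apply: hP; exists N, (p * p'); rewrite es es' ef ef' !rmorphM.
pose hA := GRing.isZmodMorphism.Build _ _ h hB.
pose hX := GRing.isMonoidMorphism.Build _ _ h hM.
pose hr : {rmorphism Sym -> S} := HB.pack h hA hX.
exists hr; split=> [c|r] /=; apply: hP.
  by exists 0%N, c%:MP; rewrite !mmapC.
by exists r.+1, 'X_ord_max; rewrite !mmapX !mmap1U.
Qed.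

End Universal.

(** * Passage from the e_r to the power sums in characteristic 0 *)

Hypothesis char0 : [pchar R] =i pred0.

Lemma elem_newton r :
  elem R r.+1 =
  (r.+1%:R^-1)%:A * \sum_(j < r.+1) (-1) ^+ j * (elem R (r - j) * psum R j).
Proof.
rewrite -newton_symfun -(scaler_nat _ (elem R r.+1)) -scalerAl mul1r scalerA.
by rewrite mulVf ?scale1r // ((pcharf0P _).1 char0).
Qed.

(** By strong induction with [elem_newton], the values on scalars and power sums determine those on
    the e_r, which generate. *)
Lemma symfun_morphism_eq (S : nzRingType) (h1 h2 : {rmorphism Sym -> S}) :
  (forall c, h1 c%:A = h2 c%:A) -> (forall r, h1 (psum R r) = h2 (psum R r)) ->
  h1 =1 h2.
Proof.
move=> hC hp f; have [N [p <-]] := ev_elem_surj f.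
have he r : h1 (elem R r) = h2 (elem R r).
  have e0 : elem R 0 = 1.
    by apply: symfun_eq => n /=; rewrite mesym0E mpolyC1.
  elim/ltn_ind: r => -[|r] IH; first by rewrite e0 !rmorph1.
  rewrite elem_newton (rmorphM h1) (rmorphM h2) hC !rmorph_sum; congr (_ * _).
  by apply: eq_bigr => j _; rewrite !rmorph_signM hp IH // ltnS leq_subr.
by rewrite !rmorph_mmap; apply: eq_mmap => [c|i] /=.
Qed.

(** Newton's identities dictate the value [b r] that e_r must take. The morphism with these values
    on the e_r then has the prescribed values on the power sums, by the same identities. *)
Lemma symfun_psum_morphism (S : comNzRingType) (iota : {rmorphism R -> S})
    (a : nat -> S) : exists h : {rmorphism Sym -> S},
  (forall c, h c%:A = iota c) /\ (forall r, h (psum R r) = a r).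
Proof.
(* [bs r] lists b_0, ..., b_r, because each new term uses all earlier ones. *)
pose fix bs r : seq S := if r is r'.+1 then
  rcons (bs r') (iota (r'.+1%:R^-1) *
    \sum_(j < r'.+1) (-1) ^+ j * ((bs r')`_(r' - j) * a j)) else [:: 1].
have size_bs r : size (bs r) = r.+1 by elim: r => //= r IH; rewrite size_rcons IH.
pose b r := (bs r)`_r.
have bsE r i : (i <= r)%N -> (bs r)`_i = b i.
  elim: r => [|r IH] /=; first by case: i.
  rewrite leq_eqVlt => /predU1P[->//|lt_ir].
  by rewrite nth_rcons size_bs lt_ir IH.
have bS r : b r.+1 *+ r.+1 = \sum_(j < r.+1) (-1) ^+ j * (b (r - j)%N * a j).
  rewrite {1}/b /= nth_rcons size_bs ltnn eqxx -mulrnAl -(rmorphMn iota).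
  rewrite -[_^-1 *+ _]mulr_natr mulVf ?rmorph1 ?mul1r ?((pcharf0P _).1 char0) //.
  by apply: eq_bigr => j _; rewrite bsE // leq_subr.
have [h [hC he]] := symfun_elem_morphism iota (b \o succn).
have he' r : h (elem R r) = b r.
  case: r => [|r]; last exact: he.
  suff -> : elem R 0 = 1 by rewrite rmorph1.
  by apply: symfun_eq => n /=; rewrite mesym0E mpolyC1.
exists h; split=> // r; elim/ltn_ind: r => r IH.
(* The terms j < r agree by induction. In the term j = r the factor e_0 is 1, so what remains is the
   image of [psum R r] up to sign. *)
have := congr1 h (newton_symfun r); rewrite rmorphMn he' bS rmorph_sum.
rewrite !big_ord_recr /= rmorph_signM he' subnn.
have -> : b 0%N = 1 by [].
rewrite !mul1r (eq_bigr (fun j : 'I_r =>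
  h ((-1) ^+ j * (elem R (r - j) * psum R j)))); last first.
  by move=> j _; rewrite rmorph_signM he' IH.
by move/addrI/lreg_sign.
Qed.

End SymFunFree.

(** * Plethystic substitutions and the multiplier [twist] *)

Lemma muni_mwiden n (R : nzRingType) (p : {mpoly R[n]}) : muni (mwiden p) = p%:P.
Proof.
elim/mpolyind: p => [|c m p _ _ IH]; first by rewrite mwiden0 muni0.
rewrite mwidenD muniD IH polyCD mwidenZ mwidenX; congr (_ + _).
rewrite muniZ muniE msuppX big_seq1 mcoeffX eqxx scale1r mnmwiden_ordmax.
rewrite expr0 alg_polyC -mul_polyC -polyCM mul_mpolyC; congr (_ *: 'X_[_])%:P.
by apply/mnmP=> i; rewrite mnmE mnmwiden_widen.
Qed.

Lemma msym_var n (R : nzRingType) (s : 'S_n) i :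
  msym s 'X_i = 'X_(s i) :> {mpoly R[n]}.
Proof. by rewrite /msym mmapX mmap1U. Qed.

Lemma Qqt_char0 : [pchar Qqt] =i pred0.
Proof.
apply/pcharf0P => n; rewrite -(rmorph_nat (@tofrac _)) tofrac_eq0.
by rewrite -mpolyC_nat mpolyC_eq0 Num.Theory.pnatr_eq0.
Qed.

(** The choice made by [epsilon] meets its specification once some morphism does; characteristic 0
    of Q(q,t) provides one. *)
Lemma subst_psumP k (a : nat -> V k) : subst_psum_spec a (subst_psum a).
Proof.
apply: epsilon_spec.
have [h hP] := symfun_psum_morphism Qqt_char0
  (@mpolyC k Lambda \o in_alg Lambda) (fun r => a r.+1).
by exists h.
Qed.

Lemma subst_psum_unique k (a : nat -> V k) (h : {rmorphism Lambda -> V k}) :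
  subst_psum_spec a h -> h =1 subst_psum a.
Proof.
move=> [hC hp]; have [sC sp] := subst_psumP a.
by apply: (symfun_morphism_eq Qqt_char0) => [c|r]; rewrite ?hC ?sC ?hp ?sp.
Qed.

(* [twist k F] is F[X + (q-1)(y_1 + ... + y_k)]. *)
Definition twist k : {rmorphism Lambda -> V k} :=
  subst_psum (fun r => (psum _ r.-1)%:MP +
                       \sum_(i < k) cst k (q ^+ r - 1) * 'X_i ^+ r).

Lemma twist_cst k c : twist k c%:A = cst k c.
Proof. exact: (subst_psumP _).1. Qed.

Lemma twist_psum k r : twist k (psum _ r) =
  (psum _ r)%:MP + \sum_(i < k) cst k (q ^+ r.+1 - 1) * 'X_i ^+ r.+1.
Proof. exact: (subst_psumP _).2. Qed.

Lemma twist0 F : twist 0 F = F%:MP.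
Proof.
apply/esym; apply: subst_psum_unique; split=> // r.
by rewrite big_ord0 addr0.
Qed.

Lemma pleth_is_zmod_morphism k e (y : V k) : zmod_morphism (pleth e y).
Proof. by move=> F G; rewrite /pleth mmapB. Qed.
HB.instance Definition _ k e (y : V k) :=
  GRing.isZmodMorphism.Build (V k) (V k) (pleth e y) (pleth_is_zmod_morphism e y).

Lemma pleth_is_monoid_morphism k e (y : V k) : monoid_morphism (pleth e y).
Proof. by split=> [|F G]; rewrite /pleth ?rmorph1 // rmorphM. Qed.
HB.instance Definition _ k e (y : V k) :=
  GRing.isMonoidMorphism.Build (V k) (V k) (pleth e y) (pleth_is_monoid_morphism e y).

Lemma plethM k e (y : V k) : {morph pleth e y : F G / F * G}.
Proof. exact: rmorphM. Qed.

Lemma pleth_cst k e (y : V k) c : pleth e y (cst k c) = cst k c.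
Proof. rewrite /pleth mmapC; exact: (subst_psumP _).1. Qed.

Lemma pleth_psum k e (y : V k) r : pleth e y (psum _ r)%:MP =
  (psum _ r)%:MP + cst k (e * (q ^+ r.+1 - 1)) * y ^+ r.+1.
Proof. rewrite /pleth mmapC; exact: (subst_psumP _).2. Qed.

Lemma pleth_var k e (y : V k) i : pleth e y 'X_i = 'X_i.
Proof. by rewrite /pleth mmapX mmap1U. Qed.

Lemma mwiden_cst k c : mwiden (cst k c) = cst k.+1 c.
Proof. exact: mwidenC. Qed.

Lemma mwiden_var k i : mwiden ('X_i : V k) = 'X_(widen_ord (leqnSn k) i).
Proof. by rewrite mwidenX mnmwiden1. Qed.

Lemma mwiden_cstXn k c i r : mwiden (cst k c * 'X_i ^+ r) =
  cst k.+1 c * 'X_(widen_ord (leqnSn k) i) ^+ r.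
Proof.
by rewrite mwidenM (rmorphXn (@mwiden k Lambda)) /= mwiden_cst mwiden_var.
Qed.

Lemma cstN k c : cst k (- c) = - cst k c.
Proof. by rewrite /cst scaleNr mpolyCN. Qed.

(** Both sides are morphisms in [F] that agree on scalars and power sums: the substitution adds
    exactly the summand of y_{k+1}. *)
Lemma pleth_twist k F : pleth 1 'X_ord_max (mwiden (twist k F)) = twist k.+1 F.
Proof.
pose h : {rmorphism Lambda -> V k.+1} :=
  pleth 1 'X_ord_max \o @mwiden k Lambda \o twist k.
rewrite -[LHS]/(h F); apply: subst_psum_unique; split=> [c|r] /=.
  by rewrite twist_cst mwiden_cst pleth_cst.
rewrite twist_psum big_ord_recr /= addrCA addrC.
rewrite mwidenD mwidenC rmorphD /= pleth_psum mul1r; congr (_ + _).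
rewrite (raddf_sum (@mwiden k Lambda)) raddf_sum; apply: eq_bigr => i _ /=.
by rewrite mwiden_cstXn rmorphM rmorphXn /= pleth_cst pleth_var.
Qed.

(** Here the substitution cancels the summand of y_{k+1} in the image of each power sum. *)
Lemma pleth_twistN k F :
  pleth (-1) 'X_ord_max (twist k.+1 F) = mwiden (twist k F).
Proof.
pose h1 : {rmorphism Lambda -> V k.+1} := pleth (-1) 'X_ord_max \o twist k.+1.
pose h2 : {rmorphism Lambda -> V k.+1} := @mwiden k Lambda \o twist k.
rewrite -[LHS]/(h1 F) -[RHS]/(h2 F).
apply: (symfun_morphism_eq Qqt_char0) => [c|r] /=.
  by rewrite !twist_cst mwiden_cst pleth_cst.
rewrite !twist_psum big_ord_recr /= mwidenD mwidenC !rmorphD /= pleth_psum /=.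
rewrite rmorphM rmorphXn /= pleth_cst pleth_var mulN1r cstN mulNr.
rewrite addrACA addrC addNr add0r; congr (_ + _).
rewrite (raddf_sum (@mwiden k Lambda)) raddf_sum; apply: eq_bigr => i _ /=.
by rewrite mwiden_cstXn rmorphM rmorphXn /= pleth_cst pleth_var.
Qed.

(** Permuting the y_i only reorders the sum in the image of each power sum. *)
Lemma msym_twist k (s : 'S_k) F : msym s (twist k F) = twist k F.
Proof.
pose h : {rmorphism Lambda -> V k} := msym s \o twist k.
rewrite -[LHS]/(h F); apply: subst_psum_unique; split=> [c|r] /=.
  by rewrite twist_cst /msym mmapC.
rewrite twist_psum rmorphD /= {1}/msym mmapC; congr (_ + _).
rewrite rmorph_sum [RHS](reindex_inj (@perm_inj _ s)) /=.
apply: eq_bigr => i _.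
by rewrite rmorphM rmorphXn /= msym_var {1}/msym mmapC.
Qed.

(** * Division by y_{i+1} - y_i and the operators T_i *)

Lemma mcoeffMX_eq0 n (A : nzRingType) (i : 'I_n) (G : {mpoly A[n]}) (m : 'X_{1..n}) :
  m i = 0%N -> (G * 'X_i)@_m = 0.
Proof.
move=> mi0; rewrite mcoeffM big1 // => -[k1 k2] /= /eqP em.
rewrite mcoeffX; case: eqP => [ek|]; last by rewrite mulr0.
by have := congr1 (fun k : 'X_{1..n} => k i) em; rewrite mi0 mnmDE -ek mnm1E eqxx addn1.
Qed.

(** The coefficients may have zero divisors, so the argument is on monomials. If X_i G = X_j G, the
    coefficient of G at [m] equals the one at m + U_i - U_j, or is 0 when X_j does not occur in [m];
    induction on the exponent of X_j concludes. *)
Lemma mulXB_inj n (A : comNzRingType) (i j : 'I_n) : i != j ->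
  injective (fun G : {mpoly A[n]} => ('X_i - 'X_j) * G).
Proof.
move=> ij G1 G2 /= e12; apply/eqP; rewrite -subr_eq0; apply/eqP.
move: (G1 - G2) (mulrBr ('X_i - 'X_j) G1 G2) => G.
rewrite {}e12 subrr mulrBl => /eqP; rewrite subr_eq0 => /eqP eG.
apply/mpolyP => m; rewrite mcoeff0.
have coefE k : G@_k = (G * 'X_j)@_(U_(i) + k).
  by rewrite -(mcoeffMX G U_(i)) mulrC eG mulrC.
move: {2}(m j) (erefl (m j)) => d; elim: d m => [|d IH] m mj.
  by rewrite coefE mcoeffMX_eq0 // mnmDE mj mnm1E (negbTE ij).
have le_jm : (U_(j) <= m)%MM by rewrite lep1mP mj.
rewrite coefE -(submK le_jm) addmA addmC mcoeffMX IH //.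
by rewrite mnmDE mnmBE !mnm1E eqxx (negbTE ij) mj subn1.
Qed.

(** The property is linear, holds for variables, and is closed under products because F1 F2 - F1'
    F2' = F1 (F2 - F2') + F2' (F1 - F1'). *)
Lemma sub_msym_tperm_dvd n (A : comNzRingType) (i j : 'I_n) (F : {mpoly A[n]}) :
  exists G, F - msym (tperm i j) F = ('X_j - 'X_i) * G.
Proof.
pose P (F : {mpoly A[n]}) := exists G, F - msym (tperm i j) F = ('X_j - 'X_i) * G.
have PM F1 F2 : P F1 -> P F2 -> P (F1 * F2).
  move=> [G1 e1] [G2 e2]; exists (F1 * G2 + msym (tperm i j) F2 * G1).
  rewrite msymM; move: (msym _ F1) (msym _ F2) e1 e2 => H1 H2 e1 e2.
  rewrite mulrDr ![('X_j - 'X_i) * _]mulrCA -e1 -e2 !mulrBr addrA.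
  by rewrite (mulrC H2 F1) subrK (mulrC H2).
have P1 : P 1 by exists 0; rewrite rmorph1 subrr mulr0.
have PX l : P 'X_l.
  rewrite /P msym_var; case: tpermP => [->|->|_ _].
  - by exists (-1); rewrite mulrN1 opprB.
  - by exists 1; rewrite mulr1.
  - by exists 0; rewrite subrr mulr0.
elim/mpolyind: F => [|c m F _ _ [G eG]].
  by exists 0; rewrite rmorph0 subrr mulr0.
have [G' eG'] : P 'X_[m].
  rewrite mpolyXE_id; apply: (big_ind P P1 PM) => l _.
  by elim: (m l) => [|d IH]; [exact: P1 | rewrite exprS; exact: PM (PX l) IH].
exists (c *: G' + G); rewrite msymD msymZ opprD addrACA eG -scalerBr eG'.
by rewrite mulrDr scalerAr.
Qed.

(** With F' = s_i F and G the divided difference, this gives T_i F = s_i F + (q-1) y_i G. It follows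
    from x1 - c x0 = (x1 - x0) - (c - 1) x0. *)
Lemma T_quotient (A : comNzRingType) (x0 x1 c F F' G : A) :
  F - F' = (x1 - x0) * G ->
  (x1 - x0) * (F' + (c - 1) * x0 * G) =
    (c - 1) * x0 * F + (x1 - c * x0) * F'.
Proof.
move=> eG; rewrite mulrDr mulrCA -eG mulrBr addrCA; congr (_ + _).
by rewrite -mulrBl; congr (_ * _); rewrite mulrBl mul1r opprB addrA subrK.
Qed.

Lemma T_spec k (i : 'I_k) (F : V k.+1) :
  let i0 := widen_ord (leqnSn k) i in let i1 := lift ord0 i in
  ('X_i1 - 'X_i0) * T i F =
    cst k.+1 (q - 1) * 'X_i0 * F
      + ('X_i1 - cst k.+1 q * 'X_i0) * msym (tperm i0 i1) F.
Proof.
move=> i0 i1; apply: (epsilon_spec (inhabits 0) (fun G : V k.+1 =>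
  ('X_i1 - 'X_i0) * G = cst k.+1 (q - 1) * 'X_i0 * F
    + ('X_i1 - cst k.+1 q * 'X_i0) * msym (tperm i0 i1) F)).
have [G eG] := sub_msym_tperm_dvd i0 i1 F.
exists (msym (tperm i0 i1) F + cst k.+1 (q - 1) * 'X_i0 * G).
have -> : cst k.+1 (q - 1) = cst k.+1 q - 1.
  by rewrite /cst scalerBl scale1r mpolyCB mpolyC1.
exact: T_quotient.
Qed.

(** As y_{i+1} - y_i is regular, the equation defining [T] has only one solution; since s_i fixes
    [P], multiplying the equation for [F] by [P] gives the one for [P * F]. *)
Lemma T_mulsym k (i : 'I_k) (P F : V k.+1) :
  (forall s, msym s P = P) -> T i (P * F) = P * T i F.
Proof.
move=> symP; apply: (@mulXB_inj _ _ (lift ord0 i) (widen_ord (leqnSn k) i)).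
  by rewrite -val_eqE /= /bump add1n neq_ltn ltnSn orbT.
rewrite T_spec [RHS]mulrCA T_spec msymM symP mulrDr.
by apply: congr2; apply: mulrCA.
Qed.

(** * Commutation of d_+, d_-, phi and path operators with the action *)

Lemma dplus_twist k F (G : V k) :
  dplus (twist k F * G) = twist k.+1 F * dplus G.
Proof.
have e : pleth 1 'X_ord_max (mwiden (twist k F * G)) =
    twist k.+1 F * pleth 1 'X_ord_max (mwiden G).
  rewrite mwidenM plethM; apply: (congr1 ( *%R^~ _)); exact: pleth_twist.
(* The multiplier is now symmetric in y_1, ..., y_{k+1}, so it passes through each T_i in turn. *)
have foldT s H : foldr (fun i H => T i H) (twist k.+1 F * H) s =
    twist k.+1 F * foldr (fun (i : 'I_k) H => T i H) H s.
  elim: s => [//|i s IH]; rewrite /= IH.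
  by apply: T_mulsym => s'; apply: msym_twist.
exact: etrans (congr1 (fun H => foldr (fun i H => T i H) H (enum 'I_k)) e) (foldT _ _).
Qed.

Lemma sum_coef_mulC (A : nzRingType) (a : A) (p : {poly A}) (c : nat -> A) :
  \sum_(j < size (a%:P * p)) (a%:P * p)`_j * c j =
  a * \sum_(j < size p) p`_j * c j.
Proof.
(* Multiplication by [a] may kill leading coefficients, so the left sum may be shorter and is padded
   with zeros. *)
have le_size : (size (a%:P * p)%R <= size p)%N.
  by rewrite mul_polyC size_scale_leq.
rewrite (big_ord_widen_cond _ xpredT (fun j => (a%:P * p)`_j * c j) le_size).
rewrite big_mkcond mulr_sumr; apply: eq_bigr => j _ /=.
case: ltnP => [_|le_j]; first by rewrite coefCM mulrA.
by rewrite mulrA -coefCM nth_default ?mul0r.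
Qed.

(** After the substitution the multiplier is free of y_{k+1}: it is a constant for [muni] and
    factors out of the coefficient extraction. *)
Lemma dminus_twist k F (G : V k.+1) :
  dminus (twist k.+1 F * G) = twist k F * dminus G.
Proof.
have e : muni (pleth (-1) 'X_ord_max (twist k.+1 F * G)) =
    (twist k F)%:P * muni (pleth (-1) 'X_ord_max G).
  rewrite plethM muniM; apply: (congr1 ( *%R^~ _)).
  by rewrite pleth_twistN muni_mwiden.
apply: etrans (congr1 (fun p : {poly V k} =>
  - \sum_(j < size p) p`_j * ((-1) ^+ j.+1 * (elem _ j.+1)%:MP)) e) _.
by rewrite (sum_coef_mulC _ _ (fun j => (-1) ^+ j.+1 * (elem _ j.+1)%:MP)) -mulrN.
Qed.

Lemma phi_twist k F (G : V k.+1) :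
  phi (twist k.+1 F * G) = twist k.+1 F * phi G.
Proof.
by rewrite /phi dplus_twist !dminus_twist dplus_twist -mulrBr mulrCA.
Qed.

Lemma letter_op_twist s k F (G : V k) :
  letter_op s (twist k F * G) = twist (shift s k) F * letter_op s G.
Proof.
(* For [North] and [Diag] on V_0 the default value 0 makes both sides vanish. *)
case: s k G => [[|k]|[|k]|k] G /=; rewrite ?mulr0 //.
- exact: dminus_twist.
- exact: phi_twist.
- exact: dplus_twist.
Qed.

Lemma word_op_twist w F :
  word_op w F%:MP = twist (level w) F * word_op w 1%:MP.
Proof.
elim: w => [|s w IH] /=; first by rewrite twist0 mpolyC1 mulr1.
by rewrite IH letter_op_twist.
Qed.

(** The index [m] is kept general so that the equality can be eliminated by cases; it is used with
    [level P = 0]. *)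
Lemma eq_rect_twist k m (e : k = m) F (G : V k) :
  eq_rect k (fun k => V k) (twist k F * G) m e =
  twist m F * eq_rect k (fun k => V k) G m e.
Proof. by case: _ / e. Qed.

Theorem corollary6p2 (P : lattice_path) (F : Lambda) : path_op P F = path_op P 1 * F.
Proof.
(* On V_0 the multiplier is the constant polynomial [F], which factors out of the constant
   coefficient. *)
by rewrite /path_op word_op_twist eq_rect_twist twist0 mcoeffCM mulrC.
Qed.
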